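(* Let $n > k \geq 3$ be integers. Then ${\tt vdw}(n,k)$ is a pseudo-manifold if and only if $\frac{n}{2} \leq k < n$. Furthermore, when ${\tt vdw}(n,k)$ is a pseudo-manifold, it has a boundary.
   Context: For integers $n > k \geq 1$, the van der Waerden complex ${\tt vdw}(n,k)$ is the simplicial complex on the vertex set $\{x_1,\ldots,x_n\}$ whose facets are exactly the sets $\{x_i, x_{i+d}, x_{i+2d}, \ldots, x_{i+kd}\}$ with $i \geq 1$, $d \geq 1$ integers and $i+kd \leq n$. It is a pure complex of dimension $k$ (the dimension of a face $F$ is $|F|-1$). A $k$-dimensional simplicial complex is a pseudo-manifold if: (1) it is pure (all facets have the same dimension); (2) every $(k-1)$-dimensional face is contained in at most two facets; and (3) given any two facets $F_a, F_b$, there is a sequence of facets $F_a = G_0, G_1, \ldots, G_m = F_b$ such that $G_i \cap G_{i+1}$ has dimension $k-1$ for all $0 \leq i \leq m-1$. A $k$-dimensional pseudo-manifold has a boundary if it has at least one $(k-1)$-dimensional face that belongs to exactly one facet. *)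

(* Defs.v *)
From mathcomp Require Import all_boot all_order all_algebra.

Set Implicit Arguments.
Unset Strict Implicit.
Unset Printing Implicit Defensive.

Import Order.TTheory GRing.Theory Num.Theory.

Local Open Scope ring_scope.

(* The complex without any face (not even set0) is allowed. *)
Record complex (T : finType) := Complex {
  faces :> {set {set T}};
  faces_closed : forall F G : {set T}, F \in faces -> G \subset F -> G \in faces
}.

(* Integer-valued, so that the empty face has dimension -1. *)
Definition face_dim (T : finType) (F : {set T}) : int := #|F|%:Z - 1.

Definition complex_dim (T : finType) (D : complex T) : int :=
  (\max_(F in faces D) #|F|)%N%:Z - 1.

Definition facets (T : finType) (D : complex T) : {set {set T}} :=
  [set F : {set T} | maxset [in faces D] F].

Definition pure (T : finType) (D : complex T) : Prop :=
  {in facets D &, forall F G : {set T}, face_dim F = face_dim G}.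

Definition facets_containing (T : finType) (D : complex T) (G : {set T}) :
  {set {set T}} := [set F in facets D | G \subset F].

(* The sequence G_0, ..., G_m is Fa :: s. *)
Definition strongly_connected (T : finType) (D : complex T) : Prop :=
  {in facets D &, forall Fa Fb : {set T},
    exists s : seq {set T},
      [/\ {subset s <= facets D},
          path (fun F G => face_dim (F :&: G) == complex_dim D - 1) Fa s
        & last Fa s = Fb]}.

Definition pseudo_manifold (T : finType) (D : complex T) : Prop :=
  [/\ pure D,
      forall G : {set T}, G \in faces D -> face_dim G = complex_dim D - 1 ->
        (#|facets_containing D G| <= 2)%N
    & strongly_connected D].

Definition has_boundary (T : finType) (D : complex T) : Prop :=
  exists G : {set T},
    [/\ G \in faces D, face_dim G = complex_dim D - 1
      & #|facets_containing D G| = 1%N].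

Definition generated_faces (T : finType) (S : {set {set T}}) : {set {set T}} :=
  [set F : {set T} | [exists G in S, F \subset G]].

Lemma generated_faces_closed (T : finType) (S : {set {set T}}) (F G : {set T}) :
  F \in generated_faces S -> G \subset F -> G \in generated_faces S.
Proof.
rewrite !inE => /existsP[H /andP[HS FH]] GF.
by apply/existsP; exists H; rewrite HS (subset_trans GF FH).
Qed.

Definition generated (T : finType) (S : {set {set T}}) : complex T :=
  Complex (@generated_faces_closed T S).

(* The vertex x_i (1 <= i <= n) is the ordinal of value i - 1. *)
Definition progression (n k i d : nat) : {set 'I_n} :=
  [set x : 'I_n | [exists j : 'I_k.+1, x.+1 == (i + j * d)%N]].

(* Bounding i and d by n loses nothing when 1 <= k: see [vdw_facetsP]. *)
Definition vdw_generators (n k : nat) : {set {set 'I_n}} :=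
  [set F : {set 'I_n} | [exists i : 'I_n.+1, exists d : 'I_n.+1,
     [&& (0 < i)%N, (0 < d)%N, (i + k * d <= n)%N & F == progression n k i d]]].

Definition vdw (n k : nat) : complex 'I_n := generated (vdw_generators n k).

Lemma card_progression (n k i d : nat) :
  (0 < i)%N -> (0 < d)%N -> (i + k * d <= n)%N -> #|progression n k i d| = k.+1.
Proof.
move=> i0 d0 le_n.
have lt (j : 'I_k.+1) : ((i + j * d).-1 < n)%N.
  rewrite prednK ?addn_gt0 ?i0 //; apply: leq_trans le_n.
  by rewrite leq_add2l leq_mul2r -ltnS ltn_ord orbT.
pose f (j : 'I_k.+1) : 'I_n := Ordinal (lt j).
have fE j : (f j).+1 = (i + j * d)%N by rewrite /= prednK ?addn_gt0 ?i0.
have f_inj : injective f.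
  move=> a b eq_ab; apply/val_inj/eqP.
  by rewrite -(eqn_pmul2r d0) -(eqn_add2l i) -!fE eq_ab.
suff -> : progression n k i d = f @: [set: 'I_k.+1].
  by rewrite card_imset // cardsT card_ord.
apply/setP=> x; rewrite inE; apply/existsP/imsetP => [[j /eqP xj] | [j _ ->]].
  by exists j; rewrite ?inE //; apply/val_inj/succn_inj; rewrite fE.
by exists j; rewrite fE.
Qed.

Lemma vdw_facetsP (n k : nat) (F : {set 'I_n}) : (0 < k)%N ->
  reflect (exists i d : nat, [/\ (1 <= i)%N, (1 <= d)%N, (i + k * d <= n)%N
                               & F = progression n k i d])
          (F \in facets (vdw n k)).
Proof.
move=> k0.
have genP G : reflect (exists i d : nat, [/\ (1 <= i)%N, (1 <= d)%N,
    (i + k * d <= n)%N & G = progression n k i d]) (G \in vdw_generators n k).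
  rewrite inE; apply: (iffP existsP) => [[i /existsP[d /and4P[? ? ? /eqP ?]]]|].
    by exists i, d.
  case=> i [d [i0 d0 le_n ->]].
  have lti : (i < n.+1)%N by rewrite ltnS (leq_trans _ le_n) ?leq_addr.
  have ltd : (d < n.+1)%N.
    by rewrite ltnS (leq_trans _ le_n) // (leq_trans (leq_pmull d k0)) ?leq_addl.
  exists (Ordinal lti); apply/existsP; exists (Ordinal ltd).
  by rewrite /= i0 d0 le_n eqxx.
have gen_card G : G \in vdw_generators n k -> #|G| = k.+1.
  by move=> /genP[i [d [? ? ? ->]]]; apply: card_progression.
suff -> : (F \in facets (vdw n k)) = (F \in vdw_generators n k) by exact: genP.
rewrite [LHS]inE; apply/maxsetP/idP => [[] | FS].
  rewrite /= [F \in _]inE => /existsP[G /andP[GS FG]] maxF.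
  rewrite -(maxF G) //= inE.
  by apply/existsP; exists G; rewrite GS subxx.
split=> /= [|G]; rewrite [_ \in _]inE.
  by apply/existsP; exists F; rewrite FS subxx.
move=> /existsP[H /andP[HS GH]] FG; apply/esym/eqP.
by rewrite eqEcard FG (gen_card F FS) -(gen_card H HS) subset_leq_card.
Qed.

(* Main.v *)
Require Import Defs.
From mathcomp Require Import all_boot all_order all_algebra.
From mathcomp Require Import zify.

Import Order.TTheory GRing.Theory Num.Theory.

Local Open Scope ring_scope.

(** The facets of [vdw n k] are the progressions of [k + 1] terms in
    [1, n]; write [d] for the common difference.

    The common difference is constant along a strongly connected component
    ([adjacent_progressions]): if two facets share [k] vertices, the shared set
    omits only one term of each.  Since [k >= 3], a progression of difference
    [d] contains the two disjoint pairs [i, i + d] and [i + 2d, i + 3d], one of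
    which survives in the shared set; so the other difference divides [d]
    ([dvdn_progression]), and symmetrically.  If [2k < n], facets of difference
    1 and 2 both exist, so [vdw n k] is not a pseudo-manifold.

    If [n <= 2k], only the difference 1 occurs, and the facets are the
    intervals [i, i + k].  Consecutive intervals share [k] vertices, whence
    strong connectivity; intervals whose starting points are at distance at
    least 2 share at most [k - 1] vertices, so a ridge lies in at most two
    facets; and the ridge [1, k] lies in the facet [1, k + 1] only. *)

(** * Faces and dimension *)

Lemma face_sub_facet (T : finType) (D : complex T) (F : {set T}) :
  F \in faces D -> exists2 G, G \in facets D & F \subset G.
Proof.
move=> FD; have [G maxG FG] := @maxset_exists T [in faces D] F FD.
by exists G; rewrite // inE.
Qed.

Lemma facet_face (T : finType) (D : complex T) (F : {set T}) :
  F \in facets D -> F \in faces D.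
Proof. by rewrite inE => /maxsetP[]. Qed.

Lemma card_facet_vdw (n k : nat) (F : {set 'I_n}) :
  (0 < k)%N -> F \in facets (vdw n k) -> #|F| = k.+1.
Proof.
move=> k0 /(vdw_facetsP _ k0)[i [d [? ? ? ->]]]; exact: card_progression.
Qed.

Lemma progression_facet (n k i d : nat) :
  (0 < k)%N -> (0 < i)%N -> (0 < d)%N -> (i + k * d <= n)%N ->
  progression n k i d \in facets (vdw n k).
Proof. by move=> k0 *; apply/vdw_facetsP => //; exists i, d. Qed.

Lemma complex_dim_vdw (n k : nat) :
  (0 < k)%N -> (k < n)%N -> complex_dim (vdw n k) = k.
Proof.
move=> k0 kn; rewrite /complex_dim.
suff -> : (\max_(F in faces (vdw n k)) #|F|)%N = k.+1 by lia.
apply/eqP; rewrite eqn_leq; apply/andP; split.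
  apply/bigmax_leqP => F /face_sub_facet[G GD FG].
  by rewrite -(card_facet_vdw _ _ _ k0 GD) subset_leq_card.
have PD : progression n k 1 1 \in facets (vdw n k).
  by apply: progression_facet => //; lia.
rewrite -(card_facet_vdw _ _ _ k0 PD).
by apply: leq_bigmax_cond; apply: facet_face.
Qed.

(** A face of codimension 1 in [vdw n k] is a face with [k] vertices. *)
Lemma ridge_vdw (n k : nat) (G : {set 'I_n}) : (0 < k)%N -> (k < n)%N ->
  (face_dim G == complex_dim (vdw n k) - 1) = (#|G| == k).
Proof. by move=> k0 kn; rewrite complex_dim_vdw // /face_dim; lia. Qed.

(** * The common difference is locally constant *)

Lemma progressionP (n k i d : nat) (x : 'I_n) :
  reflect (exists2 j, (j <= k)%N & x.+1 = (i + j * d)%N)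
          (x \in progression n k i d).
Proof.
rewrite inE; apply: (iffP existsP) => [[j /eqP xj] | [j jk xj]].
  by exists j; rewrite // -ltnS.
by exists (Ordinal (jk : (j < k.+1)%N)); rewrite xj.
Qed.

(** A subset omitting at most one element of [P] meets every pair in [P]. *)
Lemma codim1_mem (T : finType) (G P : {set T}) (x y : T) :
  G \subset P -> (#|P| <= #|G|.+1)%N -> x \in P -> y \in P -> x != y ->
  (x \in G) || (y \in G).
Proof.
move=> GP PG xP yP xy; rewrite -[_ || _]negbK negb_or.
apply/negP => /andP[xG yG].
have: ([set x; y] \subset P :\: G) by rewrite subUset !sub1set !inE xP yP xG yG.
move/subset_leq_card; rewrite cards2 xy cardsD (setIidPr GP); lia.
Qed.

(** Omitting one term of a progression with at least 4 terms leaves two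
    consecutive terms. *)
Lemma codim1_consecutive (n k i d : nat) (G : {set 'I_n}) :
  (3 <= k)%N -> (0 < i)%N -> (0 < d)%N -> (i + k * d <= n)%N ->
  G \subset progression n k i d -> (k <= #|G|)%N ->
  exists x y : 'I_n, [/\ x \in G, y \in G & nat_of_ord y = (x + d)%N].
Proof.
move=> k3 i0 d0 le_n GP cG.
have term j : (j <= k)%N -> exists2 x : 'I_n,
    x \in progression n k i d & x.+1 = (i + j * d)%N.
  move=> jk; have lt : ((i + j * d).-1 < n)%N by nia.
  have xE : (Ordinal lt).+1 = (i + j * d)%N by rewrite /=; lia.
  by exists (Ordinal lt) => //; apply/progressionP; exists j.
(* The omitted term spares one of the pairs {x0, x1} and {x2, x3}. *)
have [x0 P0 E0] := term 0%N isT.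
have [x1 P1 E1] := term 1%N (ltnW (ltnW k3)).
have [x2 P2 E2] := term 2%N (ltnW k3).
have [x3 P3 E3] := term 3%N k3.
have omit1 x y : x \in progression n k i d -> y \in progression n k i d ->
    (x < y)%N -> (x \in G) || (y \in G).
  move=> xP yP xy; apply: (codim1_mem _ _ _ _ _ GP) => //.
    by rewrite card_progression.
  by apply/eqP => eq_xy; rewrite eq_xy ltnn in xy.
have := (omit1 _ _ P0 P2, omit1 _ _ P0 P3, omit1 _ _ P1 P2, omit1 _ _ P1 P3).
case x0G: (x0 \in G); case x1G: (x1 \in G).
- by move=> _; exists x0, x1; split=> //; lia.
all: case x2G: (x2 \in G); case x3G: (x3 \in G) => /= -[[[h02 h03] h12] h13].
all: first [ by exists x2, x3; split=> //; lia
           | by have: false by first [apply: h02; lia | apply: h03; lia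
                                    | apply: h12; lia | apply: h13; lia] ].
Qed.

Lemma dvdn_progression (n k i d : nat) (x y : 'I_n) (e : nat) :
  x \in progression n k i d -> y \in progression n k i d ->
  nat_of_ord y = (x + e)%N -> (d %| e)%N.
Proof.
move=> /progressionP[a _ xa] /progressionP[b _ yb] xy.
have -> : e = ((b - a) * d)%N by rewrite mulnBl; lia.
exact: dvdn_mull.
Qed.

(** Two progressions sharing all their terms but at most one of each have the
    same difference. *)
Lemma adjacent_progressions (n k i d i' d' : nat) :
  (3 <= k)%N -> (0 < i)%N -> (0 < d)%N -> (i + k * d <= n)%N ->
  (0 < i')%N -> (0 < d')%N -> (i' + k * d' <= n)%N ->
  (k <= #|progression n k i d :&: progression n k i' d'|)%N -> d = d'.
Proof.
move=> k3 i0 d0 le_n i0' d0' le_n' cI; apply/eqP; rewrite eqn_dvd.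
have [x [y [/setIP[xP xP'] /setIP[yP yP'] xy]]] :=
  codim1_consecutive _ _ _ _ _ k3 i0 d0 le_n (subsetIl _ _) cI.
have [u [v [/setIP[uP uP'] /setIP[vP vP'] uv]]] :=
  codim1_consecutive _ _ _ _ _ k3 i0' d0' le_n' (subsetIr _ _) cI.
by rewrite (dvdn_progression _ _ _ _ _ _ _ uP vP uv)
           (dvdn_progression _ _ _ _ _ _ _ xP' yP' xy).
Qed.

Lemma strongly_connected_vdw_le (n k : nat) :
  (3 <= k)%N -> (k < n)%N -> strongly_connected (vdw n k) -> (n <= 2 * k)%N.
Proof.
move=> k3 kn conn; have k0 : (0 < k)%N by lia.
rewrite leqNgt; apply/negP => n2k.
have le1 : (1 + k * 1 <= n)%N by lia.
have le2 : (1 + k * 2 <= n)%N by lia.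
have P1 := progression_facet n k 1%N 1%N k0 isT isT le1.
have P2 := progression_facet n k 1%N 2%N k0 isT isT le2.
have [s [sD pth lst]] := conn _ _ P1 P2.
pose unit_diff (F : {set 'I_n}) :=
  exists2 i, (0 < i)%N && (i + k * 1 <= n)%N & F = progression n k i 1.
have step F G : unit_diff F -> G \in facets (vdw n k) -> (k <= #|F :&: G|)%N ->
    unit_diff G.
  move=> [i /andP[i0 le_i] ->] /(vdw_facetsP _ k0)[j [d [j0 d0 le_j ->]]] cI.
  have d1 := adjacent_progressions _ _ i 1%N _ _ k3 i0 isT le_i j0 d0 le_j cI.
  by subst d; exists j; rewrite ?j0.
(* Propagating along the path, the facet of difference 2 would also be a
   progression of difference 1. *)
have [i /andP[i0 le_i] P2E] : unit_diff (progression n k 1 2).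
  have: unit_diff (progression n k 1 1) by exists 1%N.
  rewrite -lst; elim: s (progression n k 1 1) sD pth {P1 lst} => //= G s IH F sD.
  rewrite ridge_vdw // => /andP[/eqP cI pth] uF.
  apply: IH => //; first by move=> H Hs; apply: sD; rewrite inE Hs orbT.
  by apply: step uF _ _; [apply: sD; rewrite inE eqxx | rewrite cI].
suff: 2%N = 1%N by [].
apply: (adjacent_progressions _ _ 1%N 2%N i 1%N k3 isT isT le2 i0 isT le_i).
by rewrite -P2E setIid card_progression.
Qed.

(** * Intervals *)

Lemma mem_interval (n k i : nat) (x : 'I_n) :
  (x \in progression n k i 1) = (i <= x.+1 <= i + k)%N.
Proof.
apply/progressionP/idP => [[j jk ->] | /andP[ix xi]]; first lia.
by exists (x.+1 - i)%N; lia.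
Qed.

(** When [n <= 2k], a progression of [k + 1] terms in [1, n] has difference 1. *)
Lemma facets_vdw_interval (n k : nat) (F : {set 'I_n}) :
  (0 < k)%N -> (n <= 2 * k)%N ->
  reflect (exists i, [/\ (0 < i)%N, (i + k <= n)%N & F = progression n k i 1])
          (F \in facets (vdw n k)).
Proof.
move=> k0 n2k; apply: (iffP (vdw_facetsP _ k0)) => [[i [d [i0 d0 le_n ->]]]|].
  have d1 : d = 1%N by nia.
  by exists i; subst d; split=> //; lia.
by case=> i [i0 le_n ->]; exists i, 1%N; rewrite muln1.
Qed.

Lemma pure_vdw (n k : nat) : (0 < k)%N -> pure (vdw n k).
Proof.
by move=> k0 F G FD GD; rewrite /face_dim !(card_facet_vdw _ _ _ k0).
Qed.

Lemma card_consecutive_intervals (n k i : nat) :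
  (0 < k)%N -> (0 < i)%N -> (i.+1 + k <= n)%N ->
  #|progression n k i 1 :&: progression n k i.+1 1| = k.
Proof.
move=> k0 i0 le_n.
suff -> : progression n k i 1 :&: progression n k i.+1 1
          = progression n k.-1 i.+1 1.
  by rewrite card_progression ?prednK //; lia.
by apply/setP => x; rewrite inE !mem_interval; lia.
Qed.

(** The adjacency relation on facets is symmetric, so it suffices to go up from
    one interval to the next. *)
Lemma strongly_connected_vdw (n k : nat) :
  (0 < k)%N -> (k < n)%N -> (n <= 2 * k)%N -> strongly_connected (vdw n k).
Proof.
move=> k0 kn n2k.
pose D := facets (vdw n k).
pose adj (F G : {set 'I_n}) :=
  face_dim (F :&: G) == complex_dim (vdw n k) - 1.
pose e : rel {set 'I_n} := fun F G => [&& F \in D, G \in D & adj F G].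
have e_sym : symmetric e by move=> F G; rewrite /e /adj setIC andbCA.
have up i m : (0 < i)%N -> (i + m + k <= n)%N ->
    connect e (progression n k i 1) (progression n k (i + m) 1).
  move=> i0; elim: m => [|m IH] le_n; first by rewrite addn0.
  apply: (connect_trans (IH _)); first lia.
  apply: connect1; rewrite /e /adj ridge_vdw // addnS.
  rewrite card_consecutive_intervals //; try lia.
  by rewrite eqxx !progression_facet //; lia.
have conn i j : (0 < i)%N -> (0 < j)%N -> (i + k <= n)%N -> (j + k <= n)%N ->
    connect e (progression n k i 1) (progression n k j 1).
  wlog ij : i j / (i <= j)%N => [ih | i0 _ _ jn].
    have [ij | /ltnW ji] := leqP i j; first exact: ih.
    move=> i0 j0 le_i le_j; rewrite (sym_connect_sym e_sym).
    exact: ih.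
  by rewrite -(subnKC ij); apply: up => //; rewrite subnKC.
move=> Fa Fb /(facets_vdw_interval _ _ _ k0 n2k)[i [i0 le_i ->]].
move=> /(facets_vdw_interval _ _ _ k0 n2k)[j [j0 le_j ->]].
have /connectP[s pth lst] := conn i j i0 j0 le_i le_j.
exists s; split=> //; last by apply: sub_path pth => F G /and3P[].
elim: s (progression n k i 1) pth {lst} => //= G s IH F /andP[/and3P[_ GD _] pth].
by move=> H; rewrite inE => /predU1P[-> // | Hs]; apply: IH pth _ Hs.
Qed.

(** Intervals with starting points at distance at least 2 share at most
    [k - 1] vertices. *)
Lemma close_intervals (n k i j : nat) (G : {set 'I_n}) :
  (2 <= k)%N -> (0 < i)%N -> (i + k <= n)%N -> #|G| = k ->
  G \subset progression n k i 1 -> G \subset progression n k j 1 ->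
  (j <= i.+1)%N.
Proof.
move=> k2 i0 le_i cG Gi Gj; rewrite leqNgt; apply/negP => ij.
suff: G \subset progression n (k - 2) i.+2 1.
  by move/subset_leq_card; rewrite card_progression ?cG //; lia.
apply/subsetP => x xG; move: (subsetP Gi x xG) (subsetP Gj x xG).
by rewrite !mem_interval; lia.
Qed.

Lemma card_facets_containing_vdw (n k : nat) (G : {set 'I_n}) :
  (2 <= k)%N -> (n <= 2 * k)%N -> #|G| = k ->
  (#|facets_containing (vdw n k) G| <= 2)%N.
Proof.
move=> k2 n2k cG; have k0 : (0 < k)%N by lia.
pose starts i := [&& (0 < i)%N, (i + k <= n)%N & G \subset progression n k i 1].
have [-> | [F0]] := set_0Vmem (facets_containing (vdw n k) G); first by rewrite cards0.
rewrite inE => /andP[/(facets_vdw_interval _ _ _ k0 n2k)[i0 [i00 le_i0 ->]] Gi0].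
have ex_start : exists i, starts i by exists i0; rewrite /starts i00 le_i0.
(* The facets containing G start at the least such i, or at i + 1. *)
case: (ex_minnP ex_start) => i /and3P[ipos le_i Gi] min_i.
suff sub : facets_containing (vdw n k) G
           \subset [set progression n k i 1; progression n k i.+1 1].
  by apply: leq_trans (subset_leq_card sub) _; rewrite cards2; case: eqP.
apply/subsetP => F; rewrite inE in_set2.
case/andP => /(facets_vdw_interval _ _ _ k0 n2k)[j [j0 le_j ->]] Gj.
have ij : (i <= j)%N by apply: min_i; rewrite /starts j0 le_j.
have ji := close_intervals _ _ _ _ _ k2 ipos le_i cG Gi Gj.
have [-> | ->] : j = i \/ j = i.+1 by lia.
  by rewrite eqxx.
by rewrite eqxx orbT.
Qed.

Lemma has_boundary_vdw (n k : nat) :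
  (0 < k)%N -> (k < n)%N -> (n <= 2 * k)%N -> has_boundary (vdw n k).
Proof.
move=> k0 kn n2k; pose G := progression n k.-1 1 1.
have memG x : (x \in G) = (x < k)%N by rewrite mem_interval; lia.
have P1 : progression n k 1 1 \in facets (vdw n k).
  by apply: progression_facet => //; lia.
have GP1 : G \subset progression n k 1 1.
  by apply/subsetP => x; rewrite memG mem_interval; lia.
exists G; split.
- exact: faces_closed (facet_face _ _ _ P1) GP1.
- by apply/eqP; rewrite ridge_vdw // card_progression ?prednK //; lia.
suff -> : facets_containing (vdw n k) G = [set progression n k 1 1].
  exact: cards1.
have P1G : progression n k 1 1 \in facets_containing (vdw n k) G.
  by rewrite inE P1.
apply/eqP; rewrite eqEsubset sub1set P1G andbT.
apply/subsetP => F; rewrite inE in_set1.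
case/andP => /(facets_vdw_interval _ _ _ k0 n2k)[i [i0 le_i ->]] Gi.
have n0 : (0 < n)%N by lia.
have := subsetP Gi (Ordinal n0); rewrite memG mem_interval /= => /(_ k0) i1.
by have -> : i = 1%N by lia.
Qed.

(** * The characterization *)

Theorem theorem5p4 (n k : nat) (hk : (3 <= k)%N) (hkn : (k < n)%N) :
  (pseudo_manifold (vdw n k) <->
     (n%:R / 2 <= k%:R :> rat) /\ (k%:R < n%:R :> rat)) /\
  (pseudo_manifold (vdw n k) -> has_boundary (vdw n k)).
Proof.
have k0 : (0 < k)%N by lia.
have le_of_pm : pseudo_manifold (vdw n k) -> (n <= 2 * k)%N.
  by case=> _ _; apply: strongly_connected_vdw_le.
have halfE : (n%:R / 2 <= k%:R :> rat) = (n <= 2 * k)%N.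
  by rewrite ler_pdivrMr // -natrM ler_nat mulnC.
rewrite halfE ltr_nat; split; last first.
  by move=> /le_of_pm; apply: has_boundary_vdw.
split=> [/le_of_pm // | [n2k _]]; split.
- exact: pure_vdw.
- move=> G _ /eqP; rewrite ridge_vdw // => /eqP.
  by apply: card_facets_containing_vdw; lia.
- exact: strongly_connected_vdw.
Qed.
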